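(* Let $P_7=\{123,213,321\}$ and $a_n=|A_n(P_7)|$. Then $a_0=1$, $a_1=1$, $a_2=3$, and for all $n\ge 3$ $$a_n=5a_{n-1}-3a_{n-2}.$$
   Context: A Ferrers board $F$ with $n$ rows and $n$ columns is drawn in French notation: left- and bottom-justified, row lengths weakly increasing from top to bottom. $\mathcal{F}_n$ is the family of such boards containing the staircase board (i.e. the $i$-th row from the top has at least $i$ cells for every $i$). A transversal of $F$ is a placement of $1$'s in cells of $F$ with exactly one $1$ in each row and column. Columns are numbered left to right and heights bottom to top; $\pi_c$ is the height of the $1$ in column $c$. A transversal contains a pattern $p\in\mathfrak{S}_k$ if there are columns $c_1<\cdots<c_k$ such that $\pi_{c_1}\cdots\pi_{c_k}$ is order-isomorphic to $p$ and all $k^2$ cells in these columns and in the rows of these $1$'s lie in $F$; otherwise it avoids $p$. $A_n(P)$ is the set of pairs $(T,F)$ with $F\in\mathcal{F}_n$ and $T$ a transversal of $F$ avoiding every pattern in $P$ (for $n=0$ the empty object is counted). Under the standard correspondence, $a_n=|A_n(P)|=|\mathcal{M}_n(P)|$, where $\mathcal{M}_n(P)$ is the set of perfect matchings on $\{1,\dots,2n\}$ avoiding every $p\in P$. Here a matching contains $p\in\mathfrak{S}_3$ if it has three arcs $B_1,B_2,B_3$ with opening (smaller) vertices $o(B_1)<o(B_2)<o(B_3)$, all three opening vertices smaller than all three closing vertices, and $c(B_i)<c(B_j)\iff p_i>p_j$ for the closing vertices (so $123$ is three nested arcs and $321$ is three mutually crossing arcs). *)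

(* Defs.v *)
From mathcomp Require Import all_boot all_fingroup.

Set Implicit Arguments.
Unset Strict Implicit.
Unset Printing Implicit Defensive.

(* A cell is a pair (column, height): columns are numbered from the left and
   heights from the bottom (French notation), both starting at 0. *)
Definition cell (n : nat) : finType := ('I_n * 'I_n)%type.

(* The first clause is left-justification, the second bottom-justification;
   together they force the row lengths to increase weakly from top to bottom. *)
Definition ferrers (n : nat) (F : {set cell n}) : bool :=
  [forall c : 'I_n, forall c' : 'I_n, forall h : 'I_n,
     (c' <= c) && ((c, h) \in F) ==> ((c', h) \in F)] &&
  [forall c : 'I_n, forall h : 'I_n, forall h' : 'I_n,
     (h' <= h) && ((c, h) \in F) ==> ((c, h') \in F)].

Definition row_length (n : nat) (F : {set cell n}) (h : 'I_n) : nat :=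
  #|[set c : 'I_n | (c, h) \in F]|.

(* The row at height h is the (n - h)-th one from the top. In particular all
   n rows and all n columns are nonempty. *)
Definition contains_staircase (n : nat) (F : {set cell n}) : bool :=
  [forall h : 'I_n, n - h <= row_length F h].

Definition boards (n : nat) : {set {set cell n}} :=
  [set F : {set cell n} | ferrers F && contains_staircase F].

(* T is the set of cells that carry a 1. *)
Definition transversal (n : nat) (F T : {set cell n}) : bool :=
  [&& T \subset F,
      [forall c : 'I_n, #|[set h : 'I_n | (c, h) \in T]| == 1]
    & [forall h : 'I_n, #|[set c : 'I_n | (c, h) \in T]| == 1]].

(* c lists the columns and h the heights of the 1's of an occurrence of p. *)
Definition contains_pattern (n k : nat) (F T : {set cell n}) (p : 'S_k) : bool :=
  [exists c : {ffun 'I_k -> 'I_n}, exists h : {ffun 'I_k -> 'I_n},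
    [&& [forall i : 'I_k, forall j : 'I_k, (i < j) ==> (c i < c j)],
        [forall i : 'I_k, (c i, h i) \in T],
        [forall i : 'I_k, forall j : 'I_k, (h i < h j) == (p i < p j)]
      & [forall i : 'I_k, forall j : 'I_k, (c i, h j) \in F]]].

Definition avoiders (n k : nat) (P : {set 'S_k}) : {set {set cell n} * {set cell n}} :=
  [set TF : {set cell n} * {set cell n} |
    [&& TF.2 \in boards n, transversal TF.2 TF.1
      & [forall p in P, ~~ contains_pattern TF.2 TF.1 p]]].

Definition one_line (k : nat) (p : 'S_k) : seq nat :=
  [seq (p i).+1 | i <- enum 'I_k].

Definition P7 : {set 'S_3} :=
  [set p : 'S_3 | one_line p \in [:: [:: 1; 2; 3]; [:: 2; 1; 3]; [:: 3; 2; 1]]].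

Definition a (n : nat) : nat := #|avoiders n P7|.

(* Main.v *)
Require Import Defs.
From mathcomp Require Import all_boot all_order all_algebra.
From mathcomp Require Import all_fingroup zify.

(** Walk along the boundary of a Ferrers board from its top left corner. Going
    right opens a column, going down closes a row, and hence closes the column
    that has its 1 in that row. At every moment the open columns, all of full
    height among the remaining rows, carry a permutation; the board and its
    transversal avoid the three patterns iff all these permutations do. By
    Erdos and Szekeres a permutation avoiding 123 and 321 has length at most 4,
    and only eight permutations avoid all three patterns:
    empty, 1, 12, 21, 132, 231, 312 and 3412.
    So the pairs to be counted are closed walks in a graph with eight states.

    To count the walks without encoding them, let N(n, sigma) be the number of
    admissible pairs of size n whose first |sigma| columns have full height and
    whose 1's in these columns are ordered like sigma ([profiled] below).
    If sigma contains a pattern, N(n, sigma) = 0. Otherwise the first step of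
    the walk gives, for nonempty sigma,

      N(n+1, sigma) = sum_r N(n+1, sigma followed by a last entry of rank r)
                      + N(n, sigma without its maximum)

    ([card_profiled]). The sum collects the boards whose top row is longer than
    sigma ([card_longer]). In the other boards the top row has length exactly
    |sigma|, so its 1 is the maximum of sigma, and deleting the top row with
    the column of this 1 is a bijection ([card_stops]).

    Writing E, X, Y for the values at the empty permutation, 12 and 21, the
    eight equations reduce for n >= 2 to

      E_n = X_n + Y_n + E_{n-1},
      X_n = X_{n-1} + X_{n-2} + Y_{n-1} + E_{n-1},
      Y_n = X_{n-1} + E_{n-1},

    and eliminating X and Y yields E_n = 5 E_{n-1} - 3 E_{n-2} for n >= 3. *)

Set Implicit Arguments.
Unset Strict Implicit.
Unset Printing Implicit Defensive.

Local Open Scope nat_scope.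

(** * Transversals as permutations *)

Lemma perm_ltn_neq n (s : 'S_n) (c d : 'I_n) : c < d -> nat_of_ord (s c) != s d.
Proof. by apply: contraTN => /eqP/val_inj/perm_inj->; rewrite ltnn. Qed.

Definition graph n (s : 'S_n) : {set cell n} := [set x | x.2 == s x.1].

Lemma in_graph n (s : 'S_n) c h : ((c, h) \in graph s) = (h == s c).
Proof. by rewrite inE. Qed.

Lemma graph_inj n : injective (@graph n).
Proof.
by move=> s t est; apply/permP => c; apply/eqP; rewrite -in_graph -est in_graph.
Qed.

(** The last two clauses express the avoidance of P7. In a pattern 123 or 213
    the last entry is the largest, and the cell that carries it belongs to the
    board, so all nine cells do: such an occurrence only depends on the
    permutation. For 321 the decisive cell is the one in the last column and in
    the row of the first entry. *)
Definition admissible n (s : 'S_n) (F : {set cell n}) : Prop :=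
  [/\ forall c c' h : 'I_n, c' <= c -> (c, h) \in F -> (c', h) \in F,
      forall c h h' : 'I_n, h' <= h -> (c, h) \in F -> (c, h') \in F,
      forall c, (c, s c) \in F,
      forall c0 c1 c2 : 'I_n, c0 < c1 -> c1 < c2 ->
        s c0 < s c2 -> s c1 < s c2 -> False
    & forall c0 c1 c2 : 'I_n, c0 < c1 -> c1 < c2 ->
        s c2 < s c1 -> s c1 < s c0 -> (c2, s c0) \notin F].

Lemma transversal_graph n (F T : {set cell n}) :
  Defs.transversal F T -> exists s, T = graph s.
Proof.
case/and3P=> _ /forallP colT /forallP rowT.
have /fin_all_exists[f fP] (c : 'I_n) : exists h, forall h', ((c, h') \in T) = (h' == h).
  have /cards1P[h /setP eh] := colT c.
  by exists h => h'; have := eh h'; rewrite !inE.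
have f_inj : injective f.
  move=> c d fcd; have /cards1P[e /setP ee] := rowT (f c).
  have := ee c; have := ee d; rewrite !inE {1}fcd !fP !eqxx.
  by move/esym/eqP=> -> /esym/eqP.
exists (perm f_inj); apply/setP=> -[c h]; by rewrite in_graph fP permE.
Qed.

Lemma graph_transversal n (s : 'S_n) (F : {set cell n}) :
  Defs.transversal F (graph s) <-> forall c, (c, s c) \in F.
Proof.
split=> [/and3P[/subsetP sub _ _] c | fit]; first by apply: sub; rewrite in_graph.
apply/and3P; split.
- by apply/subsetP=> -[c h]; rewrite in_graph => /eqP->.
- apply/forallP=> c; apply/cards1P; exists (s c).
  by apply/setP=> h; rewrite !inE.
- apply/forallP=> h; apply/cards1P; exists ((s^-1)%g h).
  by apply/setP=> c; rewrite !inE /= -(inj_eq (@perm_inj _ s) c) permKV eq_sym.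
Qed.

Lemma ferrersP n (F : {set cell n}) :
  ferrers F <->
  (forall c c' h : 'I_n, c' <= c -> (c, h) \in F -> (c', h) \in F) /\
  (forall c h h' : 'I_n, h' <= h -> (c, h) \in F -> (c, h') \in F).
Proof.
split=> [/andP[/forallP L /forallP D] | [L D]].
  split=> [c c' h lec Fch | c h h' leh Fch].
    by have /forallP/(_ c')/forallP/(_ h) := L c; rewrite lec Fch.
  by have /forallP/(_ h)/forallP/(_ h') := D c; rewrite leh Fch.
apply/andP; split; apply/forallP=> x; apply/forallP=> y; apply/forallP=> z.
  by apply/implyP=> /andP[]; apply: L.
by apply/implyP=> /andP[]; apply: D.
Qed.

(** The 1's of the rows at height at least h lie in distinct columns, and each
    of these columns meets the row at height h. *)
Lemma transversal_staircase n (s : 'S_n) (F : {set cell n}) :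
  ferrers F -> (forall c, (c, s c) \in F) -> contains_staircase F.
Proof.
move=> /ferrersP[_ D] fit; apply/forallP=> h.
have <- : #|[set h' : 'I_n | h <= h']| = n - h.
  have -> : [set h' : 'I_n | h <= h'] = ~: [set h' : 'I_n | h' < h].
    by apply/setP=> h'; rewrite !inE -leqNgt.
  rewrite cardsCs setCK card_ord; congr (_ - _).
  rewrite -sum1dep_card -(big_ord_widen n (fun=> 1)) ?sum1_card ?card_ord //.
  exact: ltnW.
rewrite -(card_imset _ (@perm_inj _ s^-1%g)); apply/subset_leq_card/subsetP.
move=> _ /imsetP[h' + ->].
by have := fit ((s^-1)%g h'); rewrite permKV !inE => + leh; apply: D.
Qed.

(** * Avoidance of the three patterns *)

Lemma one_line3 (p : 'S_3) :
  one_line p = [:: (p (inord 0)).+1; (p (inord 1)).+1; (p (inord 2)).+1].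
Proof.
rewrite /one_line !enum_ordSl (size0nil (size_enum_ord 0)) /=.
by do !congr (_ :: _); congr (nat_of_ord (p _)).+1;
  apply: val_inj; rewrite /= inordK.
Qed.

(** Either the last entry is the largest (123 and 213) or the entries decrease
    (321). *)
Lemma P7E (p : 'S_3) :
  let: (x, y, z) := (p (inord 0), p (inord 1), p (inord 2)) in
  (p \in P7) = ((x < z) && (y < z)) || ((z < y) && (y < x)).
Proof.
rewrite inE one_line3 !inE !eqseq_cons !andbT !eqSS.
have d i j (ij : i < j) (j3 : j < 3) : nat_of_ord (p (inord i)) != p (inord j).
  by apply: perm_ltn_neq; rewrite !inordK // (ltn_trans ij).
have := d 0 1 isT isT; have := d 0 2 isT isT; have := d 1 2 isT isT.
by move: (p _) (p _) (p _) => [x ?] [y ?] [z ?] /=; lia.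
Qed.

Lemma ord3P (i : 'I_3) : [\/ i = inord 0, i = inord 1 | i = inord 2].
Proof.
by case: i => [[|[|[|//]]] hi]; [apply: Or31 | apply: Or32 | apply: Or33];
  apply: val_inj; rewrite /= inordK.
Qed.

(** By left-justification it suffices that the last of the three columns meets
    the three rows. *)
Lemma contains_pattern3 n (s : 'S_n) (F : {set cell n}) (p : 'S_3) :
  ferrers F ->
  contains_pattern F (graph s) p <->
  exists c0 c1 c2 : 'I_n,
    [/\ c0 < c1, c1 < c2,
        [/\ (s c0 < s c1) = (p (inord 0) < p (inord 1)),
            (s c0 < s c2) = (p (inord 0) < p (inord 2))
          & (s c1 < s c2) = (p (inord 1) < p (inord 2))]
      & [/\ (c2, s c0) \in F, (c2, s c1) \in F & (c2, s c2) \in F]].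
Proof.
move=> /ferrersP[L _]; split.
  case/existsP=> c /existsP[h /and4P[/forallP inc /forallP ch /forallP iso /forallP full]].
  have lt i j : i < j -> j < 3 -> c (inord i) < c (inord j).
    move=> ij j3; have /forallP/(_ (inord j))/implyP := inc (inord i).
    by rewrite !inordK //; [apply | lia].
  have hE i : h i = s (c i) by apply/eqP; rewrite -in_graph.
  exists (c (inord 0)), (c (inord 1)), (c (inord 2)); rewrite -!hE.
  split; [exact: lt | exact: lt | |].
    have iso' i j : (h i < h j) = (p i < p j) by have /forallP/(_ j)/eqP := iso i.
    by split; apply: iso'.
  by have /forallP f := full (inord 2); split; apply: f.
case=> c0 [c1 [c2 [c01 c12 [p01 p02 p12] [f0 f1 f2]]]].
have [c [e0 e1 e2]] : exists c : {ffun 'I_3 -> 'I_n},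
    [/\ c (inord 0) = c0, c (inord 1) = c1 & c (inord 2) = c2].
  by exists [ffun i : 'I_3 => nth c0 [:: c0; c1; c2] i]; rewrite !ffunE !inordK.
apply/existsP; exists c; apply/existsP; exists [ffun i => s (c i)].
have neq i j (ij : i < j) (j3 : j < 3) : nat_of_ord (p (inord i)) != p (inord j).
  by apply: perm_ltn_neq; rewrite !inordK // (ltn_trans ij).
apply/and4P; split.
- apply/forallP=> x; apply/forallP=> y; apply/implyP; move: (ltn_trans c01 c12).
  case: (ord3P x) => ->; case: (ord3P y) => ->; rewrite ?e0 ?e1 ?e2 ?inordK //.
- by apply/forallP=> i; rewrite ffunE in_graph.
- have := neq 0 1 isT isT; have := neq 0 2 isT isT; have := neq 1 2 isT isT.
  have := perm_ltn_neq s c01; have := perm_ltn_neq s c12.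
  have := perm_ltn_neq s (ltn_trans c01 c12).
  move=> ? ? ? ? ? ?.
  apply/forallP=> i; apply/forallP=> j; rewrite !ffunE.
  by case: (ord3P i) => ->; case: (ord3P j) => ->; rewrite ?e0 ?e1 ?e2; apply/eqP; lia.
- apply/forallP=> i; apply/forallP=> j; apply: (L c2).
    by case: (ord3P i) => ->; rewrite ?e0 ?e1 ?e2; lia.
  by rewrite ffunE; case: (ord3P j) => ->; rewrite ?e0 ?e1 ?e2.
Qed.

Lemma P7_realizes (x y z : nat) :
  ((x < y) && (y < z)) || ((y < x) && (x < z)) || ((z < y) && (y < x)) ->
  exists2 p : 'S_3, p \in P7 &
    [/\ (x < y) = (p (inord 0) < p (inord 1)),
        (x < z) = (p (inord 0) < p (inord 2))
      & (y < z) = (p (inord 1) < p (inord 2))].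
Proof.
have i01 : inord 0 != inord 1 :> 'I_3 by rewrite -val_eqE /= !inordK.
have i02 : inord 0 != inord 2 :> 'I_3 by rewrite -val_eqE /= !inordK.
have i12 : inord 1 != inord 2 :> 'I_3 by rewrite -val_eqE /= !inordK.
(* The witnesses are 123, 213 and 321 themselves. *)
case/orP=> [/orP[]|] ord.
- by exists 1%g; [rewrite P7E !perm1 !inordK | rewrite !perm1 !inordK //; split; lia].
- exists (tperm (inord 0) (inord 1)); rewrite ?P7E tpermL tpermR tpermD // !inordK //.
  by split; lia.
- exists (tperm (inord 0) (inord 2)).
    by rewrite P7E tpermL tpermR (@tpermD _ _ _ (inord 1)) // 1?eq_sym // !inordK.
  by rewrite tpermL tpermR (@tpermD _ _ _ (inord 1)) // 1?eq_sym // !inordK //; split; lia.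
Qed.

Lemma avoiders_admissible n (s : 'S_n) (F : {set cell n}) :
  reflect (admissible s F) ((graph s, F) \in avoiders n P7).
Proof.
rewrite !inE /=; apply: (iffP and3P).
  case=> /andP[ferF _] /graph_transversal fit /forall_inP av.
  have [L D] := proj1 (ferrersP F) ferF.
  have {}av (c0 c1 c2 : 'I_n) : c0 < c1 -> c1 < c2 ->
      (c2, s c0) \in F -> (c2, s c1) \in F ->
      ~ (((s c0 < s c1) && (s c1 < s c2)) || ((s c1 < s c0) && (s c0 < s c2))
         || ((s c2 < s c1) && (s c1 < s c0))).
    move=> c01 c12 f0 f1 /P7_realizes[p p7 iso]; have /negP[] := av p p7.
    apply/(contains_pattern3 _ _ ferF); by exists c0, c1, c2.
  split=> // c0 c1 c2 c01 c12.
    move=> s02 s12; apply: (av c0 c1 c2) => //.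
    - by apply: (D _ (s c2)) => //; apply: ltnW.
    - by apply: (D _ (s c2)) => //; apply: ltnW.
    by have := perm_ltn_neq s c01; lia.
  move=> s21 s10; apply/negP=> f0; apply: (av c0 c1 c2) => //.
    by apply: (D _ (s c0)) => //; apply: ltnW.
  by lia.
case=> L D fit low cross.
have ferF : ferrers F by apply/ferrersP; split.
split; first by rewrite ferF (transversal_staircase ferF fit).
  exact/graph_transversal.
apply/forall_inP=> p; rewrite P7E => p7; apply/negP.
case/(contains_pattern3 _ _ ferF)=> c0 [c1 [c2 [c01 c12 [e01 e02 e12] [f0 _ _]]]].
case/orP: p7 => /andP[a1 a2]; first by apply: (low c0 c1 c2); rewrite ?e02 ?e12.
have n01 := perm_ltn_neq s c01; have n12 := perm_ltn_neq s c12.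
by apply: (negP (cross c0 c1 c2 c01 c12 _ _)) f0; lia.
Qed.

Definition placements n : {set 'S_n * {set cell n}} :=
  [set x | (graph x.1, x.2) \in avoiders n P7].

Lemma placementsP n (s : 'S_n) (F : {set cell n}) :
  reflect (admissible s F) ((s, F) \in placements n).
Proof. by rewrite in_set; apply: avoiders_admissible. Qed.

Lemma card_placements n : a n = #|placements n|.
Proof.
rewrite /a -(card_imset _ (f := fun x : 'S_n * {set cell n} => (graph x.1, x.2))); last first.
  by move=> [s F] [t G] [/graph_inj-> ->].
congr #|pred_of_set _|; apply/setP=> -[T F]; apply/idP/imsetP => [av | [[s G]]].
  have [s eT] : exists s, T = graph s.
    by move: av; rewrite !inE /= => /and3P[_ /transversal_graph].
  by exists (s, F); rewrite 1?in_set /= -eT.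
by rewrite in_set /= => ? [-> ->].
Qed.

(** * Profiles *)

Definition has_profile n (sigma : seq nat) (x : 'S_n * {set cell n}) : bool :=
  [&& size sigma <= n,
      [forall c : 'I_n, forall h : 'I_n, (c < size sigma) ==> ((c, h) \in x.2)]
    & [forall c : 'I_n, forall d : 'I_n,
         (c < size sigma) && (d < size sigma) ==>
         ((x.1 c < x.1 d) == (nth 0 sigma c < nth 0 sigma d))]].

(** The admissible pairs for which the boundary walk first opens the columns of
    the permutation sigma, given by its values counted from 0. *)
Definition profiled n sigma := [set x in placements n | has_profile sigma x].

Lemma profiledP n sigma (s : 'S_n) (F : {set cell n}) :
  reflect [/\ admissible s F, size sigma <= n,
              forall c h : 'I_n, c < size sigma -> (c, h) \in F
            & forall c d : 'I_n, c < size sigma -> d < size sigma ->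
                (s c < s d) = (nth 0 sigma c < nth 0 sigma d)]
    ((s, F) \in profiled n sigma).
Proof.
rewrite in_set; apply: (iffP andP) => [[/placementsP adm] | [adm le full ord]].
  case/and3P=> le /forallP full /forallP ord; split=> // [c h | c d] ltc.
    by have /forallP/(_ h)/implyP := full c; apply.
  by move=> ltd; have /forallP/(_ d) := ord c; rewrite ltc ltd => /eqP.
split; first exact/placementsP.
apply/and3P; split=> //=; apply/forallP=> c; apply/forallP=> d; apply/implyP.
  exact: full.
by case/andP=> ltc ltd; rewrite ord.
Qed.

(** Boolean and defined by iteration over ranges, so that it computes on explicit
    profiles. *)
Definition allowed (sigma : seq nat) : bool :=
  let h := nth 0 sigma in
  all (fun k => all (fun j => all (fun i =>
    ~~ (((h i < h k) && (h j < h k)) || ((h k < h j) && (h j < h i))))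
    (iota 0 j)) (iota 0 k)) (iota 0 (size sigma)).

Lemma allowedP sigma :
  let h := nth 0 sigma in
  reflect (forall i j k, i < j -> j < k -> k < size sigma ->
             ~~ (((h i < h k) && (h j < h k)) || ((h k < h j) && (h j < h i))))
    (allowed sigma).
Proof.
move=> h; apply: (iffP allP) => [al i j k ij jk lt | al k].
  have /al/allP/(_ j) : k \in iota 0 (size sigma) by rewrite mem_iota.
  by rewrite mem_iota => /(_ jk)/allP/(_ i); rewrite mem_iota; apply.
rewrite mem_iota => /= ltk; apply/allP=> j; rewrite mem_iota => /= jk.
by apply/allP=> i; rewrite mem_iota => /= ij; apply: al.
Qed.

(** Columns of full height contain all cells that an occurrence in them could
    need, so a pattern in the profile is an occurrence in the board. *)
Lemma profiled_allowed n sigma x : x \in profiled n sigma -> allowed sigma.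
Proof.
case: x => s F /profiledP[[_ _ _ low cross] le full ord].
apply/allowedP=> i j k ij jk lt.
have ltn l : l <= k -> l < n by move=> lk; apply: leq_ltn_trans lk (leq_trans lt le).
have [jk' ik] := (ltnW jk, ltnW (ltn_trans ij jk)).
pose o l lk : 'I_n := Ordinal (ltn l lk).
rewrite -(ord (o i ik) (o k (leqnn k))) -?(ord (o j jk') (o k (leqnn k)))
        -?(ord (o k (leqnn k)) (o j jk')) -?(ord (o j jk') (o i ik)) /=; try lia.
apply/orP=> -[] /andP[a1 a2]; first by apply: (low (o i ik) (o j jk') (o k (leqnn k))).
by have /negP[] := cross (o i ik) (o j jk') (o k (leqnn k)) ij jk a1 a2; apply: full.
Qed.

Lemma card_profiled_forbidden n sigma : ~~ allowed sigma -> #|profiled n sigma| = 0.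
Proof.
move=> bad; apply: eq_card0 => x; apply/negP=> /profiled_allowed ok.
by rewrite ok in bad.
Qed.

Lemma card_profiled_small n sigma : n < size sigma -> #|profiled n sigma| = 0.
Proof.
move=> lt; apply: eq_card0 => -[s F]; apply/negP=> /profiledP[_ le _ _].
by rewrite ltnNge le in lt.
Qed.

Definition standard (sigma : seq nat) := perm_eq sigma (iota 0 (size sigma)).

Lemma standard_lt sigma i : standard sigma -> i < size sigma -> nth 0 sigma i < size sigma.
Proof. by move=> /perm_mem st /(mem_nth 0); rewrite st mem_iota. Qed.

Lemma standard_index sigma r : standard sigma -> r < size sigma ->
  index r sigma < size sigma.
Proof. by move=> /perm_mem st lt; rewrite index_mem st mem_iota. Qed.

(** Appends a last entry of value r and raises the entries that are at least r,
    so that a permutation of 0, ..., m - 1 becomes one of 0, ..., m. *)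
Definition append_rank (sigma : seq nat) r := rcons (map (bump r) sigma) r.

Lemma size_append_rank sigma r : size (append_rank sigma r) = (size sigma).+1.
Proof. by rewrite size_rcons size_map. Qed.

Lemma nth_append_rank sigma r i : i < size sigma ->
  nth 0 (append_rank sigma r) i = bump r (nth 0 sigma i).
Proof. by move=> lt; rewrite nth_rcons size_map lt (nth_map 0). Qed.

Lemma nth_append_rank_last sigma r : nth 0 (append_rank sigma r) (size sigma) = r.
Proof. by rewrite nth_rcons size_map ltnn eqxx. Qed.

(** The column m right after those of the profile is the one whose 1 the new
    entry describes. *)
Lemma profiled_append_rank n sigma r (m : 'I_n) (s : 'S_n) F : m = size sigma :> nat ->
  (s, F) \in profiled n (append_rank sigma r) <->
  [/\ (s, F) \in profiled n sigma, forall h, (m, h) \in F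
    & forall c : 'I_n, c < m -> (s c < s m) = (nth 0 sigma c < r)].
Proof.
move=> em.
have lt_bump x : (bump r x < r) = (x < r) by rewrite /bump; lia.
have gt_bump x : (r < bump r x) = ~~ (x < r) by rewrite /bump; lia.
have bump2 x y : (bump r x < bump r y) = (x < y) by rewrite /bump; lia.
split=> [/profiledP | [/profiledP]]; rewrite ?size_append_rank -?em.
  case=> adm le full ord; split=> [|h|c cm]; last 1 first.
  - rewrite ord //; last exact: ltnW.
    by rewrite nth_append_rank -?em // em nth_append_rank_last lt_bump.
  - apply/profiledP; rewrite -em.
    split=> // [|c h cm|c d cm dm]; [exact: ltnW | by apply: full; exact: ltnW |].
    by rewrite ord; try exact: ltnW; rewrite !nth_append_rank -?em // bump2.
  - exact: full.
case=> adm le full ord fullm ordm; apply/profiledP; rewrite size_append_rank -em.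
split=> // [c h|c d].
  by rewrite ltnS leq_eqVlt => /orP[/eqP/val_inj->|]; [exact: fullm | exact: full].
rewrite !ltnS leq_eqVlt => /orP[/eqP/val_inj->|cm];
  rewrite leq_eqVlt => /orP[/eqP/val_inj->|dm].
- by rewrite !ltnn.
- rewrite (@nth_append_rank _ _ d) -?em // em nth_append_rank_last gt_bump -ordm //.
  rewrite -leqNgt ltn_neqAle.
  case: eqP => [/ord_inj/perm_inj e|//].
  by rewrite e ltnn in dm.
- by rewrite nth_append_rank -?em // em nth_append_rank_last lt_bump ordm.
- by rewrite !nth_append_rank -?em // bump2 ord.
Qed.

(** * Opening one more column *)

(** Given a profile of sigma, the top row has length at least the size of sigma,
    and this set singles out the pairs for which it is longer. *)
Definition longer_top_row n (sigma : seq nat) : {set 'S_n.+1 * {set cell n.+1}} :=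
  [set x : 'S_n.+1 * {set cell n.+1} |
    [exists c : 'I_n.+1, (size sigma <= c) && ((c, ord_max) \in x.2)]].

Lemma standard_nth sigma r : standard sigma -> r < size sigma ->
  exists2 i, i < size sigma & nth 0 sigma i = r.
Proof.
move=> st lt; exists (index r sigma); first exact: standard_index.
by rewrite nth_index // (perm_mem st) mem_iota.
Qed.

(** A column that reaches the top row has full height, and so have all columns
    to its left. *)
Lemma longerP n sigma (m : 'I_n.+1) (s : 'S_n.+1) F : m = size sigma :> nat ->
  admissible s F -> reflect (forall h, (m, h) \in F) ((s, F) \in longer_top_row n sigma).
Proof.
move=> em [L D _ _ _]; rewrite inE /=; apply: (iffP existsP) => [[c /andP[mc Fc]] h | full].
  by apply: (D _ ord_max); rewrite ?leq_ord // (L c) // em.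
by exists m; rewrite em leqnn full.
Qed.

(** The columns whose 1 is below that of column m form a down-set for the values
    of sigma; the rank is one more than the largest value in it, or 0 if it is
    empty. *)
Lemma exists_rank n sigma (m : 'I_n) (s : 'S_n) :
  standard sigma -> m = size sigma :> nat ->
  (forall c d : 'I_n, c < m -> d < m ->
     (s c < s d) = (nth 0 sigma c < nth 0 sigma d)) ->
  exists2 r, r <= m & forall c : 'I_n, c < m -> (s c < s m) = (nth 0 sigma c < r).
Proof.
move=> st em ord.
exists (\max_(c : 'I_n | (c < m) && (s c < s m)) (nth 0 sigma c).+1).
  by apply/bigmax_leqP => c /andP[cm _]; rewrite em; apply: standard_lt; rewrite -?em.
move=> c cm; apply/idP/idP => [scm | ltc].
  by apply: (bigmax_sup c); rewrite ?cm.
have /existsP[d /and3P[dm sdm le]] :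
    [exists d : 'I_n, [&& d < m, s d < s m & nth 0 sigma c <= nth 0 sigma d]].
  apply: contraLR ltc; rewrite negb_exists -leqNgt => /forallP none.
  apply/bigmax_leqP => d /andP[dm sdm].
  by have := none d; rewrite dm sdm /= -ltnNge.
by apply: leq_ltn_trans sdm; rewrite leqNgt ord // -leqNgt.
Qed.

(** The rank exists by [exists_rank], and it is unique because sigma takes every
    value below its size: two different ranks would disagree on the entry whose
    value is the smaller one. *)
Lemma card_longer n sigma : standard sigma -> size sigma <= n ->
  #|profiled n.+1 sigma :&: longer_top_row n sigma|
    = \sum_(r < (size sigma).+1) #|profiled n.+1 (append_rank sigma r)|.
Proof.
move=> st le; pose m : 'I_n.+1 := Ordinal (le : size sigma < n.+1).
have em : m = size sigma :> nat by [].
transitivity (\sum_x \sum_(r < (size sigma).+1) (x \in profiled n.+1 (append_rank sigma r) : nat));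
  last first.
  by rewrite exchange_big; apply: eq_bigr => r _; rewrite -sum1_card [RHS]big_mkcond.
rewrite -sum1_card big_mkcond; apply: eq_bigr => -[s F] _; rewrite inE.
case: ifPn => [/andP[prof gr] | not]; last first.
  rewrite big1 // => r _; apply/eqP; rewrite eqb0; apply: contra not.
  case/(profiled_append_rank _ _ _ em) => prof full _; rewrite prof.
  by case/profiledP: (prof) => adm _ _ _; apply/(longerP em adm).
have /profiledP[adm _ _ ord] := prof; have full := longerP em adm gr.
have [r0 r0m r0P] := exists_rank st em ord.
rewrite (bigD1 (Ordinal (r0m : r0 < (size sigma).+1))) //= big1 => [|r ne].
  by apply/eqP; rewrite addn0 eq_sym eqb1; apply/(profiled_append_rank _ _ _ em).
apply/eqP; rewrite eqb0; apply/negP=> /(profiled_append_rank _ _ _ em)[_ _ rP].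
have agree i : i < size sigma -> (nth 0 sigma i < r0) = (nth 0 sigma i < r).
  move=> lt; have c_lt : i < n.+1 by apply: leq_trans lt (leqW le).
  by rewrite -(r0P (Ordinal c_lt)) // -(rP (Ordinal c_lt)).
case: (ltngtP r r0) => [lt|lt|e]; last by rewrite -val_eqE /= e eqxx in ne.
  have [i im e] := standard_nth st (leq_trans lt r0m).
  by have := agree i im; rewrite e lt ltnn.
have [i im e] := standard_nth st (leq_trans lt (ltn_ord r)).
by have := agree i im; rewrite e lt ltnn.
Qed.

(** * Closing the top row *)

(** A board with n + 1 columns is made from G by inserting a column of full
    height at position j and then a top row of length k + 1. *)
Definition add_row n k (j : 'I_n.+1) (G : {set cell n}) : {set cell n.+1} :=
  [set x | match unlift j x.1, unlift ord_max x.2 with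
           | _, None => x.1 <= k
           | None, Some _ => true
           | Some c, Some h => (c, h) \in G
           end].

Lemma add_row_top n k j (G : {set cell n}) c :
  ((c, ord_max) \in add_row k j G) = (c <= k).
Proof. by rewrite inE /= unlift_none; case: (unlift j c). Qed.

Lemma add_row_column n k j (G : {set cell n}) h :
  ((j, lift ord_max h) \in add_row k j G).
Proof. by rewrite inE /= unlift_none liftK. Qed.

Lemma add_row_lift n k j (G : {set cell n}) c h :
  ((lift j c, lift ord_max h) \in add_row k j G) = ((c, h) \in G).
Proof. by rewrite inE /= !liftK. Qed.

Lemma add_row_inj n k j : injective (@add_row n k j).
Proof.
move=> G H e; apply/setP=> -[c h].
by rewrite -(add_row_lift k j) e add_row_lift.
Qed.

Lemma lift_perm_inj n (i j : 'I_n.+1) : injective (@lift_perm n i j).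
Proof.
move=> s t e; apply/permP=> c; apply: (@lift_inj _ j).
by rewrite -!(lift_perm_lift i) e.
Qed.

Lemma lift_perm_surj n (i j : 'I_n.+1) (t : 'S_n.+1) :
  t i = j -> exists s : 'S_n, t = lift_perm i j s.
Proof.
move=> tij; pose u c := odflt c (unlift j (t (lift i c))).
have uK c : lift j (u c) = t (lift i c).
  rewrite /u; case: unliftP => [d -> //|].
  by rewrite -[j in RHS]tij => /perm_inj/eqP; rewrite lift_eqF.
have u_inj : injective u.
  by move=> c d e; apply: (@lift_inj _ i); apply: (@perm_inj _ t); rewrite -!uK e.
exists (perm u_inj); apply/permP=> c.
case: (unliftP i c) => [d|] ->; last by rewrite lift_perm_id.
by rewrite lift_perm_lift permE uK.
Qed.

Lemma nth_rem sigma x i :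
  nth 0 (rem x sigma) i = nth 0 sigma (bump (index x sigma) i).
Proof.
elim: sigma i => [|y sigma IH] i /=; first by rewrite !nth_nil.
case: eqP => _; first by rewrite /bump leq0n.
by case: i => [|i] //=; rewrite IH bumpS.
Qed.

Lemma ltn_lift n (i : 'I_n.+1) (c d : 'I_n) : (lift i c < lift i d) = (c < d).
Proof. by rewrite /= /bump; lia. Qed.

(** Here sigma is a profile of size k + 1, its maximum k stands in position j,
    and the top row of the larger board closes the column j. *)
Section TopRow.

Variables (n k : nat) (sigma : seq nat) (j : 'I_n.+1).
Hypotheses (st : standard sigma) (ok : allowed sigma).
Hypotheses (size_sigma : size sigma = k.+1) (le_kn : k <= n).
Hypothesis (jE : j = index k sigma :> nat).

Let j_le : j <= k.
Proof. by rewrite jE -ltnS -size_sigma standard_index // size_sigma. Qed.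

Let nth_j : nth 0 sigma j = k.
Proof. by rewrite jE nth_index // (perm_mem st) mem_iota size_sigma /=. Qed.

Let size_rem_sigma : size (rem k sigma) = k.
Proof. by rewrite size_rem ?size_sigma // (perm_mem st) mem_iota size_sigma /=. Qed.

Let lift_le (c : 'I_n) : (lift j c < k.+1) = (c < k).
Proof. by move: j_le; rewrite /= /bump; lia. Qed.

Let nth_rem_lift (c : 'I_n) : nth 0 (rem k sigma) c = nth 0 sigma (lift j c).
Proof. by rewrite nth_rem -jE. Qed.

Let nth_lt (c : 'I_n) : lift j c < k.+1 -> nth 0 sigma (lift j c) < k.
Proof.
move=> ck; have := standard_lt st (etrans (congr1 (leq _) size_sigma) ck).
rewrite size_sigma ltnS leq_eqVlt => /orP[/eqP e|//].
have := index_uniq 0 (etrans (congr1 (leq _) size_sigma) ck).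
rewrite (perm_uniq st) iota_uniq e -jE => /(_ isT)/val_inj/eqP.
by rewrite eq_liftF.
Qed.

Lemma profiled_add_row (s : 'S_n) (G : {set cell n}) :
  (lift_perm j ord_max s, add_row k j G) \in profiled n.+1 sigma ->
  (s, G) \in profiled n (rem k sigma).
Proof.
case/profiledP=> -[L D fit low cross] _ full ord.
apply/profiledP; rewrite size_rem_sigma; split=> // [|c h ck|c d ck dk].
- split=> [c c' h le|c h h' le|c|c0 c1 c2 c01 c12 s02 s12|c0 c1 c2 c01 c12 s21 s10].
  + by rewrite -!(add_row_lift k j); apply: L; rewrite leqNgt ltn_lift -leqNgt.
  + by rewrite -!(add_row_lift k j); apply: D; rewrite leqNgt ltn_lift -leqNgt.
  + by rewrite -(add_row_lift k j) -(lift_perm_lift j) fit.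
  + by apply: (low (lift j c0) (lift j c1) (lift j c2)); rewrite ?lift_perm_lift ltn_lift.
  + rewrite -(add_row_lift k j) -(lift_perm_lift j).
    by apply: (cross _ (lift j c1)); rewrite ?lift_perm_lift ltn_lift.
- by rewrite -(add_row_lift k j); apply: full; rewrite size_sigma lift_le.
- rewrite -(ltn_lift ord_max) -!(lift_perm_lift j) ord ?size_sigma ?lift_le //.
  by rewrite !nth_rem_lift.
Qed.

(** A forbidden configuration in the larger board either avoids column j, and
    then comes from the smaller one, or uses the 1 of column j. That 1 is the
    highest, so the row that the configuration needs is the top row; hence its
    columns are among the first k + 1 and it is visible in sigma. *)
Lemma add_row_profiled (s : 'S_n) (G : {set cell n}) :
  (s, G) \in profiled n (rem k sigma) ->
  (lift_perm j ord_max s, add_row k j G) \in profiled n.+1 sigma.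
Proof.
case/profiledP; rewrite size_rem_sigma => -[L D fit low cross] _ full ord.
have fullF (c h : 'I_n.+1) : c < k.+1 -> (c, h) \in add_row k j G.
  case: (unliftP ord_max h) => [h'|] ->; last by rewrite add_row_top.
  case: (unliftP j c) => [c'|] ->; last by rewrite add_row_column.
  by rewrite lift_le add_row_lift; apply: full.
have ordF (c d : 'I_n.+1) : c < k.+1 -> d < k.+1 ->
    (lift_perm j ord_max s c < lift_perm j ord_max s d) = (nth 0 sigma c < nth 0 sigma d).
  case: (unliftP j c) => [c'|] ->; case: (unliftP j d) => [d'|] -> ck dk.
  - rewrite !lift_perm_lift ltn_lift ord -?lift_le //.
    by rewrite !nth_rem_lift.
  - by rewrite lift_perm_lift lift_perm_id nth_j lift_max ltn_ord nth_lt.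
  - rewrite lift_perm_lift lift_perm_id nth_j lift_max.
    by rewrite ltnNge ltnW ?ltn_ord // ltnNge ltnW // nth_lt.
  - by rewrite !ltnn.
have sj_max (c d : 'I_n.+1) : c = j ->
    lift_perm j ord_max s c < lift_perm j ord_max s d -> False.
  by move->; rewrite lift_perm_id ltnNge -ltnS ltn_ord.
have lowk (c0 c1 c2 : 'I_n.+1) : c0 < c1 -> c1 < c2 -> c2 < k.+1 ->
    ~~ (((lift_perm j ord_max s c0 < lift_perm j ord_max s c2) &&
         (lift_perm j ord_max s c1 < lift_perm j ord_max s c2)) ||
        ((lift_perm j ord_max s c2 < lift_perm j ord_max s c1) &&
         (lift_perm j ord_max s c1 < lift_perm j ord_max s c0))).
  move=> c01 c12 c2k; have c1k := ltn_trans c12 c2k; have c0k := ltn_trans c01 c1k.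
  by rewrite !ordF //; apply: (allowedP _ ok) => //; rewrite size_sigma.
apply/profiledP; rewrite size_sigma; split=> //; split.
- move=> c c' h le.
  case: (unliftP ord_max h) => [h'|] ->; last by rewrite !add_row_top; apply: leq_trans.
  case: (unliftP j c') le => [c1|] -> le; last by rewrite add_row_column.
  case: (unliftP j c) le => [c2|] -> le; rewrite !add_row_lift.
    by apply: L; rewrite leqNgt -(ltn_lift j) -leqNgt.
  by move=> _; apply: full; rewrite -lift_le ltnS (leq_trans le).
- move=> c h h' le.
  case: (unliftP ord_max h) le => [h1|] -> le.
    case: (unliftP ord_max h') le => [h2|] -> le; last first.
      by have := leq_trans le (leq_ord _); rewrite lift_max leqNgt ltn_ord in le.
    case: (unliftP j c) => [c1|] ->; last by rewrite !add_row_column.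
    by rewrite !add_row_lift; apply: D; rewrite leqNgt -(ltn_lift ord_max) -leqNgt.
  by rewrite add_row_top => ck; apply: fullF.
- move=> c; case: (unliftP j c) => [c1|] ->.
    by rewrite lift_perm_lift add_row_lift fit.
  by rewrite lift_perm_id add_row_top.
- move=> c0 c1 c2 c01 c12 s02 s12.
  case: (unliftP j c2) => [d2 e2|e2]; last first.
    have c2k : c2 < k.+1 by rewrite e2 ltnS.
    by have := lowk _ _ _ c01 c12 c2k; rewrite s02 s12.
  case: (unliftP j c0) => [d0 e0|e0]; last by apply: sj_max e0 s02.
  case: (unliftP j c1) => [d1 e1|e1]; last by apply: sj_max e1 s12.
  move: c01 c12 s02 s12; rewrite e0 e1 e2 !lift_perm_lift !ltn_lift; exact: low.
- move=> c0 c1 c2 c01 c12 s21 s10.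
  case: (unliftP j c0) => [d0 e0|e0]; last first.
    rewrite e0 lift_perm_id add_row_top -ltnS; apply/negP => /(lowk _ _ _ c01 c12).
    by rewrite s21 s10 orbT.
  case: (unliftP j c1) => [d1 e1|e1]; last by case: (sj_max _ _ e1 s10).
  case: (unliftP j c2) => [d2 e2|e2]; last by case: (sj_max _ _ e2 s21).
  move: c01 c12 s21 s10; rewrite e0 e1 e2 !lift_perm_lift !ltn_lift add_row_lift.
  exact: cross.
Qed.

(** When the top row has length k + 1, its 1 is the highest of the first k + 1
    columns, so it stands in the column j of the maximum of sigma. *)
Lemma add_row_surj (t : 'S_n.+1) (F : {set cell n.+1}) :
  (t, F) \in profiled n.+1 sigma -> (t, F) \notin longer_top_row n sigma ->
  exists s G, t = lift_perm j ord_max s /\ F = add_row k j G.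
Proof.
case/profiledP=> -[L D fit low cross] _ full ord stop.
have top c : ((c, ord_max) \in F) = (c <= k).
  apply/idP/idP => [Fc | ck]; last by apply: full; rewrite size_sigma.
  rewrite leqNgt; apply: contra stop => kc; rewrite inE /=.
  by apply/existsP; exists c; rewrite size_sigma kc.
have tj : t j = ord_max.
  set c := (t^-1)%g ord_max; have tc : t c = ord_max by rewrite permKV.
  have ck : c < size sigma by rewrite size_sigma ltnS -top -tc fit.
  apply/eqP; apply: contraT => ne.
  have : t j < t c by rewrite tc ltn_neqAle val_eqE ne leq_ord.
  rewrite ord ?size_sigma // -?size_sigma // nth_j ltnNge -ltnS -size_sigma.
  by rewrite standard_lt.
have [s es] := lift_perm_surj tj.
exists s, [set x | (lift j x.1, lift ord_max x.2) \in F]; split=> //.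
apply/setP=> -[c h].
case: (unliftP ord_max h) => [h'|] ->; last by rewrite add_row_top top.
case: (unliftP j c) => [c'|] ->; first by rewrite add_row_lift inE.
by rewrite add_row_column full // size_sigma.
Qed.

Lemma add_row_stops (s : 'S_n) (G : {set cell n}) :
  (lift_perm j ord_max s, add_row k j G) \notin longer_top_row n sigma.
Proof.
rewrite inE; apply/existsP=> -[c /=]; rewrite add_row_top size_sigma.
by case: leqP.
Qed.

Lemma card_stops :
  #|profiled n.+1 sigma :\: longer_top_row n sigma| = #|profiled n (rem k sigma)|.
Proof.
pose f (x : 'S_n * {set cell n}) := (lift_perm j ord_max x.1, add_row k j x.2).
have f_inj : injective f.
  by case=> s G [t H] [/lift_perm_inj /= -> /add_row_inj /= ->].
rewrite -(card_imset _ f_inj); congr #|pred_of_set _|; apply/setP=> -[t F].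
apply/setDP/imsetP => [[prof stop] | [[s G] prof [-> ->]]].
  have [s [G [et eF]]] := add_row_surj prof stop.
  by exists (s, G); [apply: profiled_add_row; rewrite -et -eF | rewrite et eF].
by split; [apply: add_row_profiled | apply: add_row_stops].
Qed.

End TopRow.

(** The first step of the boundary walk: it either opens one more column or
    closes the row of the highest open 1. *)
Lemma card_profiled n sigma :
  standard sigma -> allowed sigma -> 0 < size sigma ->
  #|profiled n.+1 sigma| =
    \sum_(r < (size sigma).+1 | allowed (append_rank sigma r))
       #|profiled n.+1 (append_rank sigma r)|
    + #|profiled n (rem (size sigma).-1 sigma)|.
Proof.
rewrite big_rmcond => [|r]; last exact: card_profiled_forbidden.
case sz: (size sigma) => [//|k] st ok _ /=.
have kin : k \in sigma by rewrite (perm_mem st) mem_iota sz /=.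
have size_rem : size (rem k sigma) = k by rewrite size_rem ?sz.
(* Too many columns for the board: both sides are empty. *)
have [le|lt] := leqP k n; last first.
  rewrite !card_profiled_small ?sz ?size_rem // big1 // => r _.
  by rewrite card_profiled_small // size_append_rank sz; apply: leqW.
have j_lt : index k sigma < n.+1.
  by apply: leq_trans (standard_index st _) _; rewrite sz.
rewrite -(cardsID (longer_top_row n sigma)) (card_stops (k := k) (j := Ordinal j_lt)) //.
congr (_ + _); have [lt|ge] := leqP (size sigma) n.
  by rewrite card_longer // sz.
(* All columns are open already: the top row cannot be longer. *)
rewrite big1 => [|r _]; last by rewrite card_profiled_small // size_append_rank.
apply: eq_card0 => -[s F]; rewrite !inE /=; apply/negP=> /andP[_ /existsP[c /andP[c1 _]]].
by have := leq_trans ge c1; rewrite leqNgt ltn_ord.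
Qed.

(** * The recurrence *)

Lemma card_placements_nil n : #|placements n| = #|profiled n [::]|.
Proof.
apply: eq_card => -[s F]; apply/idP/profiledP => [/placementsP adm | [adm _ _ _]].
  by split.
exact/placementsP.
Qed.

Lemma card_placements0 : #|placements 0| = 1.
Proof.
rewrite (_ : placements 0 = setT) ?cardsT.
  by rewrite card_prod card_Sn -cardsT -powersetT card_powerset cardsT card_prod card_ord.
apply/setP=> -[s F]; rewrite in_setT; apply/placementsP.
by split=> [[]|[]|[]|[]|[]].
Qed.

(** No column is open at the start and the top row is not empty, so the walk has
    to open a column. *)
Lemma card_profiled_nil n : #|profiled n.+1 [::]| = #|profiled n.+1 [:: 0]|.
Proof.
rewrite -(cardsID (longer_top_row n [::])) card_longer // big_ord1.
rewrite [X in _ + X]eq_card0 ?addn0 // => -[s F]; apply/negP=> /setDP[/profiledP[]].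
case=> _ _ fit _ _ _ _ _; rewrite inE /= => /existsP[].
by exists ((s^-1)%g ord_max); rewrite -[X in (_, X)](permKV s) fit.
Qed.

(** The transitions between the nonempty allowed profiles, the entries being
    counted from 0: for instance the profile [2; 3; 0; 1] is 3412. *)
Lemma profile_recurrences n :
  [/\ #|profiled n.+1 [:: 0]| =
        #|profiled n.+1 [:: 1; 0]| + #|profiled n.+1 [:: 0; 1]| + #|profiled n [::]|,
      #|profiled n.+1 [:: 0; 1]| =
        #|profiled n.+1 [:: 1; 2; 0]| + #|profiled n.+1 [:: 0; 2; 1]| + #|profiled n [:: 0]|,
      #|profiled n.+1 [:: 1; 0]| =
        #|profiled n.+1 [:: 2; 0; 1]| + #|profiled n [:: 0]|,
      #|profiled n.+1 [:: 0; 2; 1]| = #|profiled n [:: 0; 1]|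
    & [/\ #|profiled n.+1 [:: 1; 2; 0]| =
            #|profiled n.+1 [:: 2; 3; 0; 1]| + #|profiled n [:: 1; 0]|,
          #|profiled n.+1 [:: 2; 0; 1]| = #|profiled n [:: 0; 1]|
        & #|profiled n.+1 [:: 2; 3; 0; 1]| = #|profiled n [:: 2; 0; 1]|]].
Proof.
by split; [| | | | split]; rewrite card_profiled // big_mkcond !big_ord_recl big_ord0
  /= ?addn0 ?add0n.
Qed.

Local Open Scope ring_scope.

Theorem theorem25 :
  [/\ a 0 = 1%N, a 1 = 1%N, a 2 = 3%N
    & forall n : nat, (3 <= n)%N ->
        (a n)%:Z = 5 * (a (n - 1)%N)%:Z - 3 * (a (n - 2)%N)%:Z].
Proof.
have aE n : a n = #|profiled n [::]| by rewrite card_placements card_placements_nil.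
have a0 : a 0 = 1%N by rewrite card_placements card_placements0.
have a1 : a 1 = 1%N.
  have [e _ _ _ _] := profile_recurrences 0.
  by rewrite aE card_profiled_nil e -aE a0 !card_profiled_small.
split=> // [|[|[|[|k]]] // _].
  have [e x y _ _] := profile_recurrences 1.
  rewrite aE card_profiled_nil e x y -card_profiled_nil -aE a1.
  by rewrite !card_profiled_small.
(* With n = k + 3, the equations of sizes k + 3 and k + 2 form a linear system
   from which the recurrence follows. *)
rewrite !subSS subn0 !aE !card_profiled_nil.
have [e3 x3 y3 w3 [v3 z3 t3]] := profile_recurrences k.+2.
have [e2 _ y2 _ [_ z2 _]] := profile_recurrences k.+1.
rewrite !card_profiled_nil in e2 e3; lia.
Qed.
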